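(* There is an absolute constant $C>0$ such that for every integer $k \ge 1$ with $\sqrt{k}\in\mathbb{N}$, we have \[ c_{G_k} \le 2^{C\sqrt{k}\log^2 k}. \]
   Context: For $k$ a perfect square, $G_k$ is the $k\times k$ binary matrix whose $1$-entries are exactly at the positions $(a+b\sqrt{k}+1,\ b+a\sqrt{k}+1)$ for all $a,b\in\{0,\dots,\sqrt{k}-1\}$ (a permutation matrix). A binary matrix $A$ contains a binary matrix $B$ if $B$ can be obtained from $A$ by deleting some rows, some columns, and changing some $1$-entries to $0$-entries; otherwise $A$ avoids $B$. $\mathrm{ex}(n,B)$ is the maximum number of $1$-entries in an $n\times n$ binary matrix avoiding $B$. For a permutation matrix $P$, $c_P=\lim_{n\to\infty}\mathrm{ex}(n,P)/n$ (this limit exists and is finite). Logarithms are base $2$. *)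

(* Defs.v *)
From HB Require Import structures.
From mathcomp Require Import all_boot all_order all_algebra.
From mathcomp Require Import all_classical all_reals all_analysis.

Set Implicit Arguments.
Unset Strict Implicit.
Unset Printing Implicit Defensive.

Import Order.TTheory GRing.Theory Num.Theory.
Import numFieldNormedType.Exports.

Local Open Scope ring_scope.

Definition increasing_ord p m (f : {ffun 'I_p -> 'I_m}) : bool :=
  [forall i : 'I_p, forall j : 'I_p, (i < j)%N ==> (f i < f j)%N].

(* The submatrix [mxsub f g A] is what remains of A after deleting the rows
   outside the range of f and the columns outside the range of g. *)
Definition contains m n p q (A : 'M[bool]_(m, n)) (B : 'M[bool]_(p, q)) : bool :=
  [exists f : {ffun 'I_p -> 'I_m}, exists g : {ffun 'I_q -> 'I_n},
    [&& increasing_ord f, increasing_ord g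
      & [forall i, forall j, B i j ==> mxsub f g A i j]]].

Definition avoids m n p q (A : 'M[bool]_(m, n)) (B : 'M[bool]_(p, q)) : bool :=
  ~~ contains A B.

Definition weight m n (A : 'M[bool]_(m, n)) : nat :=
  #|[set ij : 'I_m * 'I_n | A ij.1 ij.2]|.

Definition ex n p q (B : 'M[bool]_(p, q)) : nat :=
  \max_(A : 'M[bool]_n | avoids A B) weight A.

(* [G s] is the s^2 x s^2 matrix G_k for k = s^2; indices start at 0, hence no
   "+1" in the two coordinates. *)
Definition G (s : nat) : 'M[bool]_(s ^ 2) :=
  \matrix_(i, j) [exists a : 'I_s, exists b : 'I_s,
    (i == a + b * s :> nat)%N && (j == b + a * s :> nat)%N].

Definition ex_ratio (R : realType) p q (B : 'M[bool]_(p, q)) : R^nat :=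
  fun n => (ex n B)%:R / n%:R.

(* [limn] is total, so this is meaningful only together with
   [cvgn (ex_ratio R P)]. *)
Definition c_ (R : realType) k (P : 'M[bool]_k) : R := limn (ex_ratio R P).
Arguments c_ R {k} P.

Definition log2 (R : realType) (x : R) : R := ln x / ln 2.

(* Main.v *)
Require Import Defs.
From mathcomp Require Import all_boot all_order all_algebra.
From mathcomp Require Import all_classical all_reals all_analysis.
From mathcomp Require Import zify lra.

(* A Marcus-Tardos recursion with t x t blocks, t = 4 w ^ 2 and w = s 2 ^ d, where
   2 ^ (d - 1) < s <= 2 ^ d. Only the bound on the number of wide blocks (those with at
   least w nonempty columns) in a column of blocks has to be improved from the t ^ k of a
   plain pigeonhole to 2 ^ O(s log ^ 2 k). Contract each wide block to a row. First
   cut the t columns into s intervals, the same for many rows, each containing at least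
   2 ^ d ones of every surviving row. Then, d times, cut all s intervals at their medians,
   again the same for many rows, and let the upper half of these rows keep the left parts
   and the lower half the right parts. Every cut is one choice
   among at most (t + 1) ^ (s + 1). In the
   end there are 2 ^ d >= s groups of rows, and inside each of the s intervals successive
   groups use successive disjoint subintervals: this is the order pattern of G s. *)

Set Implicit Arguments.
Unset Strict Implicit.
Unset Printing Implicit Defensive.

Import Order.TTheory GRing.Theory Num.Theory.
Import numFieldNormedType.Exports.

Local Open Scope nat_scope.

(** * Grids: the order pattern of [G s] inside relations on [nat] *)

Definition lexlt (x y x' y' : nat) : bool := (x < x') || (x == x') && (y < y').

(** Entry [(a, b)] of [G s] lies in row [a + b * s] and column [b + a * s]: rows are ordered by [b]
    first, columns by [a] first. *)
Definition has_grid (s : nat) (A : nat -> nat -> bool) : Prop :=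
  exists r c : nat -> nat -> nat, forall a b, a < s -> b < s ->
    A (r a b) (c a b) /\
    forall a' b', a' < s -> b' < s ->
      (lexlt b a b' a' -> r a b < r a' b') /\
      (lexlt a b a' b' -> c a b < c a' b').

(** Exchanging [a] and [b] transposes the pattern, so results on wide blocks also apply to tall
    ones. *)
Lemma has_grid_tr s (A : nat -> nat -> bool) :
  has_grid s (fun i j => A j i) -> has_grid s A.
Proof.
move=> [r [c H]]; exists (fun a b => c b a), (fun a b => r b a) => a b as_ bs.
have [Aab Hab] := H b a bs as_; split=> // a' b' as' bs'.
by have [] := Hab b' a' bs' as'.
Qed.

(** Monotone maps reflect strict inequalities, so picking a preimage of each entry preserves the
    pattern. This undoes contractions and shifts. *)
Lemma has_grid_lift s (A B : nat -> nat -> bool) (phi psi : nat -> nat) :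
  {homo phi : i j / i <= j} -> {homo psi : i j / i <= j} ->
  (forall I J, B I J -> exists i j, [/\ phi i = I, psi j = J & A i j]) ->
  has_grid s B -> has_grid s A.
Proof.
move=> phiM psiM BA [r [c H]].
have /choice[h hP] : forall ab : nat * nat, exists ij : nat * nat,
    ab.1 < s -> ab.2 < s -> [/\ phi ij.1 = r ab.1 ab.2,
      psi ij.2 = c ab.1 ab.2 & A ij.1 ij.2].
  move=> [a b] /=; case: (ltnP a s) => [as_|]; last by exists (0, 0).
  case: (ltnP b s) => [bs|]; last by exists (0, 0).
  by have [i [j ?]] := BA _ _ (H a b as_ bs).1; exists (i, j).
exists (fun a b => (h (a, b)).1), (fun a b => (h (a, b)).2) => a b as_ bs.
have [ra ca Aab] := hP (a, b) as_ bs; split=> // a' b' as' bs'.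
have [ra' ca' _] := hP (a', b') as' bs'.
have [Hr Hc] := (H a b as_ bs).2 a' b' as' bs'.
split=> /[dup] ? => [/Hr|/Hc]; rewrite ltnNge => /negP N; rewrite ltnNge; apply/negP.
  by move/phiM; rewrite ra ra' /= => /N.
by move/psiM; rewrite ca ca' /= => /N.
Qed.

(** * Pigeonhole over rows and vectors of cut points *)

Lemma pigeonhole (T : finType) (Q : nat -> T -> bool) (rows : seq nat) :
  (forall r, r \in rows -> exists x, Q r x) -> 0 < size rows ->
  exists x, size rows <= #|T| * size [seq r <- rows | Q r x].
Proof.
move=> HQ rows0.
have [x0 _] : exists x0 : T, true.
  by case: rows HQ rows0 => // r rows /(_ r (mem_head _ _)) [x _] _; exists x.
pose F x := size [seq r <- rows | Q r x].
have [x _ xmax] := @arg_maxnP T x0 xpredT F isT; exists x.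
apply: (@leq_trans (\sum_(y : T) F y)).
  have {rows0 xmax} : all (fun r => [exists y, Q r y]) rows.
    by apply/allP => r /HQ ?; apply/existsP.
  rewrite {}/F {HQ}; elim: rows => [//|r rows IH] /= /andP[/existsP[y Qy] /IH H].
  rewrite (bigD1 y) //= Qy /=; rewrite (bigD1 y) //= in H.
  rewrite addSn ltnS; apply: leq_trans H _; rewrite leq_add2l.
  by apply: leq_sum => i _; case: (Q r i) => //=; apply: leqnSn.
rewrite -sum_nat_const; apply: leq_sum => y _; exact: xmax.
Qed.

(** A condition on the first [s] values of [p] only can be read on the finite type of vectors of
    length [s] with entries at most [t]. *)
Lemma pigeonhole_fun s t (Q : nat -> (nat -> nat) -> Prop) (rows : seq nat) :
  (forall r p p', (forall a, a < s -> p a = p' a) -> Q r p -> Q r p') ->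
  (forall r, r \in rows -> exists2 p, forall a, a < s -> p a <= t & Q r p) ->
  0 < size rows ->
  exists p rows', [/\ subseq rows' rows, forall a, a < s -> p a <= t,
    forall r, r \in rows' -> Q r p & size rows <= t.+1 ^ s * size rows'].
Proof.
move=> Qext HQ rows0.
pose e (h : {ffun 'I_s -> 'I_t.+1}) a : nat := if insub a is Some i then h i else 0.
have [r rrows|h] := @pigeonhole {ffun 'I_s -> 'I_t.+1} (fun r h => `[< Q r (e h) >]) rows _ rows0.
  have [p pt Qp] := HQ r rrows.
  exists [ffun a : 'I_s => inord (p a)]; apply/asboolP; apply: Qext Qp => a as_.
  by rewrite /e insubT ffunE inordK // ltnS pt.
rewrite card_ffun !card_ord => Hh.
exists (e h), [seq r <- rows | `[< Q r (e h) >]]; split => //.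
- exact: filter_subseq.
- by move=> a as_; rewrite /e insubT -ltnS.
- by move=> r; rewrite mem_filter => /andP[/asboolP].
Qed.

(** * Cutting column intervals, and grids in wide rows *)

(** Cut at the least [m] whose prefix holds [p] ones: the terms are 0 or 1, so this prefix holds no
    more than [p]. *)
Lemma split_sum (P : pred nat) x y p q : x <= y ->
  p + q <= \sum_(x <= j < y) P j ->
  exists m, [/\ x <= m, m <= y, p <= \sum_(x <= j < m) P j
    & q <= \sum_(m <= j < y) P j].
Proof.
move=> xy H.
have exm : exists m, (x <= m) && (p <= \sum_(x <= j < m) P j).
  by exists y; rewrite xy (leq_trans (leq_addr _ _) H).
case: (ex_minnP exm) => m /andP[xm pm] mmin; exists m.
have my : m <= y by apply: mmin; rewrite xy (leq_trans (leq_addr _ _) H).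
split=> //; rewrite (big_cat_nat xm my) /= in H.
rewrite -(leq_add2l p); apply: leq_trans H _; rewrite leq_add2r.
case: (ltngtP x m) xm => // [xm|<-] _; last by rewrite big_geq.
case: m xm pm mmin {my} => // m; rewrite ltnS => xm _ mmin.
rewrite big_nat_recr //=.
have : \sum_(x <= j < m) P j < p.
  by rewrite ltnNge; apply/negP => pm; have := mmin m; rewrite xm pm ltnn => /(_ isT).
by case: (P m) => /=; lia.
Qed.

Lemma quantiles (P : pred nat) s q x y : x <= y ->
  s * q <= \sum_(x <= j < y) P j ->
  exists p : nat -> nat, [/\ p 0 = x, {homo p : i j / i <= j}, forall i, p i <= y
    & forall a, a < s -> q <= \sum_(p a <= j < p a.+1) P j].
Proof.
elim: s x => [|s IH] x xy H; first by exists (fun=> x); split.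
have [m [xm my qm /(IH m my)[p [p0 pM py pq]]]] := split_sum xy H.
exists (fun i => if i is i'.+1 then p i' else x); split=> //.
- case=> [|i] [|j] //=; last by rewrite ltnS; apply: pM.
  by move=> _; rewrite (leq_trans xm) // -p0 pM.
- by case.
- by case=> [_|a /pq//]; rewrite p0.
Qed.

(* One round: pigeonhole on the vector of medians of the [s] column intervals; the
   upper half of the surviving rows keeps the left halves of all the intervals,
   the lower half keeps the right halves. *)
Lemma refine_grid s t (B : nat -> nat -> bool) d rows (l u : nat -> nat) :
  0 < s -> sorted ltn rows -> (forall a, a < s -> l a <= u a <= t) ->
  (forall r a, r \in rows -> a < s -> 2 ^ d <= \sum_(l a <= j < u a) B r j) ->
  s * (2 * t.+1 ^ s) ^ d <= size rows ->
  exists f c : nat -> nat -> nat, forall a b, a < s -> b < 2 ^ d ->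
    [/\ f a b \in rows, l a <= c a b < u a, B (f a b) (c a b)
      & forall a' b', a' < s -> b' < 2 ^ d ->
        (lexlt b a b' a' -> f a b < f a' b') /\ (b < b' -> c a b < c a b')].
Proof.
move=> s0; elim: d rows l u => [|d IH] rows l u srt lu cnt sz.
  (* For [d = 0] only [b = 0] occurs, and the [a]-th surviving row provides the entry of the [a]-th
     interval. *)
  rewrite expn0 muln1 in sz.
  have /choice[c cP] : forall a, exists c, a < s ->
      l a <= c < u a /\ B (nth 0 rows a) c.
    move=> a; case: (ltnP a s) => [as_|]; last by exists 0.
    have := cnt _ _ (mem_nth 0 (leq_trans as_ sz)) as_; rewrite expn0 => Hc.
    have [/hasP[c]|/hasPn N] := boolP (has (B (nth 0 rows a)) (index_iota (l a) (u a))).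
      by rewrite mem_index_iota => ? ?; exists c.
    move: Hc; rewrite big_seq big1 // => j /N; by case: (B _ j).
  exists (fun a _ => nth 0 rows a), (fun a _ => c a) => a b as_; rewrite ltnS leqn0 => /eqP->.
  have [cl Bc] := cP a as_; split=> //; first exact: mem_nth (leq_trans as_ sz).
  move=> a' b' as'; rewrite ltnS leqn0 => /eqP->; split => //.
  rewrite /lexlt ltnn eqxx /= => aa'.
  by rewrite (sorted_ltn_nth ltn_trans) // inE (leq_trans _ sz).
pose X := (2 * t.+1 ^ s) ^ d.
have X0 : 0 < s * X by rewrite muln_gt0 s0 expn_gt0 muln_gt0 expn_gt0.
have rows0 : 0 < size rows.
  by apply: leq_trans sz; rewrite expnS mulnCA muln_gt0 muln_gt0 expn_gt0.
have [||m [rows' [sub mt Qm sz']]] := @pigeonhole_fun s t (fun r p => forall a, a < s ->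
   [/\ l a <= p a, p a <= u a, 2 ^ d <= \sum_(l a <= j < p a) B r j
     & 2 ^ d <= \sum_(p a <= j < u a) B r j]) rows _ _ rows0.
- by move=> r p p' pp' H a as_; rewrite -pp' //; apply: H.
- move=> r rr.
  have /choice[p pP] : forall a, exists p, a < s ->
     [/\ l a <= p, p <= u a, 2 ^ d <= \sum_(l a <= j < p) B r j
     & 2 ^ d <= \sum_(p <= j < u a) B r j].
    move=> a; case: (ltnP a s) => [as_|]; last by exists 0.
    have /andP[lua _] := lu a as_.
    have := cnt r a rr as_; rewrite expnS mul2n -addnn => /(split_sum lua)[p ?].
    by exists p.
  exists p => // a as_; have /andP[_ ut] := lu a as_.
  by have [_ pu _ _] := pP a as_; apply: leq_trans ut.
have srt' : sorted ltn rows' by apply: subseq_sorted sub srt; exact: ltn_trans.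
(* The pigeonhole costs the factor [t.+1 ^ s]; the factor 2 pays for an upper part of [s * X] rows
   and a lower part at least as large. *)
have {sz'}sz : 2 * (s * X) <= size rows'.
  have : t.+1 ^ s * (2 * (s * X)) <= t.+1 ^ s * size rows'.
    apply: leq_trans sz'; apply: leq_trans sz; rewrite expnS -/X.
    by move: (t.+1 ^ s) => T; lia.
  by rewrite leq_pmul2l // expn_gt0.
have lmu a : a < s -> l a <= m a <= u a.
  have [r rr] : exists r, r \in rows' by exists (nth 0 rows' 0); apply: mem_nth; lia.
  by move=> as_; have [-> ->] := Qm r rr a as_.
have [||||f1 [c1 H1]] := IH (take (s * X) rows') l m.
- exact: take_sorted.
- by move=> a as_; rewrite mt // andbT; case/andP: (lmu a as_).
- by move=> r a /mem_take /Qm /(_ a) H /H [].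
- by rewrite size_takel // (leq_trans _ sz) // mul2n -addnn leq_addr.
have [||||f2 [c2 H2]] := IH (drop (s * X) rows') m u.
- exact: drop_sorted.
- by move=> a as_; have /andP[_ ->] := lu a as_; case/andP: (lmu a as_) => _ ->.
- by move=> r a /mem_drop /Qm /(_ a) H /H [].
- by rewrite -/X size_drop -(leq_add2l (s * X)) -maxnE addnn -mul2n (leq_trans sz) // leq_maxr.
have f12 r1 r2 : r1 \in take (s * X) rows' -> r2 \in drop (s * X) rows' -> r1 < r2.
  move=> h1 h2; move: srt'; rewrite -{1}(cat_take_drop (s * X) rows') sorted_pairwise;
    last exact: ltn_trans.
  by rewrite pairwise_cat => /and3P[/allrelP /(_ _ _ h1 h2)].
(* Groups [b < 2 ^ d] come from the upper rows; the others, renumbered from 0, from the lower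
   rows. *)
exists (fun a b => if b < 2 ^ d then f1 a b else f2 a (b - 2 ^ d)),
       (fun a b => if b < 2 ^ d then c1 a b else c2 a (b - 2 ^ d)) => a b as_.
rewrite expnS mul2n -addnn => bd.
have := lmu a as_; case: (ltnP b (2 ^ d)) => b2 /andP[lm mu].
  have [fr cr Bfc H] := H1 a b as_ b2; split=> //.
  + exact: (mem_subseq sub) (mem_take fr).
  + by case/andP: cr => -> /= /leq_trans ->.
  move=> a' b' as' bd'; case: (ltnP b' (2 ^ d)) => b2'; first exact: H.
  have bd'' : b' - 2 ^ d < 2 ^ d by lia.
  have [fr' _ _ _] := H2 a' _ as' bd''; split=> _; first exact: f12.
  have [_ cr' _ _] := H2 a _ as_ bd''; lia.
have bd2 : b - 2 ^ d < 2 ^ d by lia.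
have [fr cr Bfc H] := H2 a _ as_ bd2; split=> //.
+ exact: (mem_subseq sub) (mem_drop fr).
+ by case/andP: cr => + ->; rewrite andbT; apply: leq_trans.
move=> a' b' as' bd'; case: (ltnP b' (2 ^ d)) => b2'; first by rewrite /lexlt; split; lia.
have bd'' : b' - 2 ^ d < 2 ^ d by lia.
have [Hf Hc] := H a' _ as' bd''; split.
  by move=> L; apply: Hf; move: L; rewrite /lexlt; lia.
by move=> bb'; apply: Hc; lia.
Qed.

(** The quantile intervals are disjoint and increase with [a], and [refine_grid] orders the columns
    inside each of them by [b]. *)
Lemma has_grid_wide_rows s t d (B : nat -> nat -> bool) rows :
  0 < s -> s <= 2 ^ d -> sorted ltn rows ->
  (forall r, r \in rows -> s * 2 ^ d <= \sum_(0 <= j < t) B r j) ->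
  t.+1 ^ s.+1 * (s * (2 * t.+1 ^ s) ^ d) <= size rows ->
  has_grid s B.
Proof.
move=> s0 sd srt cnt sz.
have X0 : 0 < s * (2 * t.+1 ^ s) ^ d by rewrite muln_gt0 s0 expn_gt0 muln_gt0 expn_gt0.
have rows0 : 0 < size rows.
  by apply: leq_trans sz; rewrite muln_gt0 X0 expn_gt0.
(* Monotonicity is asked only up to index [s], so that the condition depends on the [s.+1] cut
   points alone. *)
have [||p [rows' [sub pt Qp sz']]] := @pigeonhole_fun s.+1 t (fun r p =>
   (forall a b, a <= b <= s -> p a <= p b) /\
   forall a, a < s -> 2 ^ d <= \sum_(p a <= j < p a.+1) B r j) rows _ _ rows0.
- move=> r p p' pp' [pM H]; split=> [a b ab|a as_].
    by rewrite -!pp' ?pM; lia.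
  by rewrite -!pp' ?H; lia.
- move=> r rr; have [p [_ pM pt pq]] := quantiles (leq0n t) (cnt r rr).
  by exists p => //; split=> // a b /andP[/pM].
have sz0 : s * (2 * t.+1 ^ s) ^ d <= size rows'.
  by have := leq_trans sz sz'; rewrite leq_pmul2l // expn_gt0.
have pM a b : a <= b <= s -> p a <= p b.
  have [r rr] : exists r, r \in rows'.
    by exists (nth 0 rows' 0); apply: mem_nth; exact: leq_trans X0 sz0.
  by have [+ _] := Qp r rr; apply.
have [||||f [c H]] := @refine_grid s t B d rows' p (fun a => p a.+1) s0.
- by apply: subseq_sorted sub srt; exact: ltn_trans.
- by move=> a as_; rewrite pM ?pt; lia.
- by move=> r a /Qp[_]; apply.
- exact: sz0.
exists f, c => a b as_ bs; have [_ c1 Bfc Hf] := H a b as_ (leq_trans bs sd); split=> //.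
move=> a' b' as' bs'; have [Hf1 Hf2] := Hf a' b' as' (leq_trans bs' sd); split=> //.
rewrite /lexlt => /orP[aa'|/andP[/eqP aa' bb']]; last by subst a'; exact: Hf2.
have [_ c2 _ _] := H a' b' as' (leq_trans bs' sd).
have : p a.+1 <= p a' by apply: pM; rewrite aa' ltnW.
by lia.
Qed.

(** * Contraction into blocks and the linear bound on the weight *)

Definition wt (A : nat -> nat -> bool) m n : nat :=
  \sum_(0 <= i < m) \sum_(0 <= j < n) A i j.

Definition rowhit t (A : nat -> nat -> bool) I j : bool :=
  has (fun i => A i j) (index_iota (I * t) (I.+1 * t)).

(** For the transposed relation, with [I] and [J] exchanged, this counts the nonempty rows of the
    same block. *)
Definition width t (A : nat -> nat -> bool) I J : nat :=
  \sum_(J * t <= j < J.+1 * t) rowhit t A I j.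

Definition block t (A : nat -> nat -> bool) I J : bool :=
  has (rowhit t A I) (index_iota (J * t) (J.+1 * t)).

Definition blockwt t (A : nat -> nat -> bool) I J : nat :=
  \sum_(I * t <= i < I.+1 * t) \sum_(J * t <= j < J.+1 * t) A i j.

(** The number of rows required by [has_grid_wide_rows]: [t.+1 ^ s.+1] for the initial cuts,
    [2 * t.+1 ^ s] for each of [d] rounds, and [s] rows at the end. *)
Definition wide_bound s d t : nat := t.+1 ^ s.+1 * (s * (2 * t.+1 ^ s) ^ d).

Lemma leq_wt (A : nat -> nat -> bool) m n m' n' :
  m <= m' -> n <= n' -> wt A m n <= wt A m' n'.
Proof.
move=> mm nn; apply: (@leq_trans (wt A m n')).
  by apply: leq_sum => i _; rewrite [leqRHS](big_cat_nat (leq0n _) nn) leq_addr.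
by rewrite [leqRHS]/wt (big_cat_nat (leq0n _) mm) leq_addr.
Qed.

Lemma wt_blocks t (A : nat -> nat -> bool) m n :
  wt A (m * t) (n * t) = \sum_(0 <= I < m) \sum_(0 <= J < n) blockwt t A I J.
Proof.
rewrite /wt big_nat_mul; apply: eq_bigr => I _.
under eq_bigr do rewrite big_nat_mul.
by rewrite exchange_big.
Qed.

Lemma mem_block t i I : 0 < t -> (i \in index_iota (I * t) (I.+1 * t)) = (i %/ t == I).
Proof.
move=> t0; rewrite mem_index_iota eqn_leq -[_ %/ t <= I]ltnS ltn_divLR //.
by rewrite leq_divRL // andbC.
Qed.

Lemma width_le t (A : nat -> nat -> bool) I J : width t A I J <= t.
Proof.
rewrite /width -[leqRHS](addnK (J * t)) -mulSn -[leqRHS]muln1 -sum_nat_const_nat.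
by apply: leq_sum => j _; apply: leq_b1.
Qed.

Lemma blockwt_le t (A : nat -> nat -> bool) I J :
  blockwt t A I J <= width t A I J * width t (fun i j => A j i) J I.
Proof.
rewrite mulnC /width big_distrlr /= /blockwt big_seq [leqRHS]big_seq.
apply: leq_sum => i ti; rewrite big_seq [leqRHS]big_seq; apply: leq_sum => j tj.
case Aij: (A i j) => //=; rewrite lt0n muln_eq0 !eqb0 negb_or !negbK.
by apply/andP; split; apply/hasP; [exists j|exists i].
Qed.

Lemma blockwt0 t (A : nat -> nat -> bool) I J :
  ~~ block t A I J -> blockwt t A I J = 0.
Proof.
move=> /hasPn nb; apply/eqP; rewrite -leqn0; apply: leq_trans (blockwt_le _ _ _ _) _.
rewrite [width t A I J]/width big_seq big1 // => j /nb.
by rewrite /rowhit => /negbTE->.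
Qed.

Lemma has_grid_block s t (A : nat -> nat -> bool) :
  0 < t -> has_grid s (block t A) -> has_grid s A.
Proof.
move=> t0; apply: (@has_grid_lift _ _ _ (fun i => i %/ t) (fun j => j %/ t)).
- by move=> i j; apply: leq_div2r.
- by move=> i j; apply: leq_div2r.
move=> I J /hasP[j tj /hasP[i ti Aij]]; exists i, j; split=> //.
  by apply/eqP; rewrite -mem_block.
by apply/eqP; rewrite -mem_block.
Qed.

(** With more wide blocks, contracting each row band to a single row would give the hypotheses of
    [has_grid_wide_rows], and its grid would lift back to [A]. *)
Lemma count_wide s d t (A : nat -> nat -> bool) m J :
  0 < s -> s <= 2 ^ d -> 0 < t -> ~ has_grid s A ->
  \sum_(0 <= I < m) (s * 2 ^ d <= width t A I J) <= wide_bound s d t.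
Proof.
move=> s0 sd t0 nA; rewrite leqNgt; apply/negP => /ltnW wb; apply: nA.
pose rows := [seq I <- index_iota 0 m | s * 2 ^ d <= width t A I J].
have : has_grid s (fun I j => rowhit t A I (j + J * t)).
  apply: (@has_grid_wide_rows s t d _ rows) => //.
  - by apply: sorted_filter; [exact: ltn_trans|exact: iota_ltn_sorted].
  - move=> I; rewrite mem_filter => /andP[+ _].
    by rewrite /width -{1}[J * t]add0n big_addn mulSn addnK.
  - apply: leq_trans wb _; rewrite /rows size_filter -sum1_count [leqRHS]big_mkcond /=.
    by apply: leq_sum => I _; case: (s * 2 ^ d <= _).
apply: (@has_grid_lift _ _ _ (fun i => i %/ t) (fun j => j - J * t)).
- by move=> i j; apply: leq_div2r.
- by move=> i j; apply: leq_sub2r.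
move=> I j /hasP[i ti Aij]; exists i, (j + J * t); rewrite addnK; split=> //.
by apply/eqP; rewrite -mem_block.
Qed.

(** A block neither wide nor tall holds at most [w ^ 2] ones; any other holds at most [t ^ 2]. By
    [count_wide] each column of blocks has few wide ones and, by transposition, each row of blocks
    few tall ones. *)
Lemma wt_contract s d t (A : nat -> nat -> bool) m :
  0 < s -> s <= 2 ^ d -> 0 < t -> ~ has_grid s A ->
  wt A (m * t) (m * t) <=
    (s * 2 ^ d) ^ 2 * wt (block t A) m m + 2 * (m * (wide_bound s d t * t ^ 2)).
Proof.
move=> s0 sd t0 nA; pose At i j := A j i.
have nAt : ~ has_grid s At by move=> /has_grid_tr.
pose w := s * 2 ^ d.
have wI J : (\sum_(0 <= I < m) (w <= width t A I J)) * t ^ 2 <= wide_bound s d t * t ^ 2.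
  by rewrite leq_mul2r count_wide ?orbT.
have wJ I : (\sum_(0 <= J < m) (w <= width t At J I)) * t ^ 2 <= wide_bound s d t * t ^ 2.
  by rewrite leq_mul2r count_wide ?orbT.
have H I J : blockwt t A I J <= w ^ 2 * block t A I J +
    ((w <= width t A I J) * t ^ 2 + (w <= width t At J I) * t ^ 2).
  have [b|/blockwt0->//] := boolP (block t A I J).
  apply: leq_trans (blockwt_le _ _ _ _) _.
  have W1 := width_le t A I J; have W2 := width_le t At J I.
  rewrite -/At -!mulnn; move: (width t A I J) (width t At J I) W1 W2 => x y xt yt.
  case: (leqP w x) => wx /=; first by have := leq_mul xt yt; lia.
  case: (leqP w y) => wy /=; first by have := leq_mul xt yt; lia.
  have := leq_mul (ltnW wx) (ltnW wy); lia.
rewrite wt_blocks.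
apply: (@leq_trans (\sum_(0 <= I < m) \sum_(0 <= J < m) (w ^ 2 * block t A I J +
    ((w <= width t A I J) * t ^ 2 + (w <= width t At J I) * t ^ 2)))).
  by apply: leq_sum => I _; apply: leq_sum => J _; apply: H.
under eq_bigr do rewrite !big_split /=.
rewrite !big_split /= leq_add //.
  by rewrite /wt big_distrr /=; apply: leq_sum => I _; rewrite big_distrr.
rewrite mul2n -addnn leq_add //.
  rewrite exchange_big /= -[m in m * _]subn0 -sum_nat_const_nat; apply: leq_sum => J _.
  by rewrite -big_distrl.
rewrite -[m in m * _]subn0 -sum_nat_const_nat; apply: leq_sum => I _.
by rewrite -big_distrl.
Qed.

Lemma wt_linear s d t (A : nat -> nat -> bool) n :
  0 < s -> s <= 2 ^ d -> 4 * (s * 2 ^ d) ^ 2 <= t -> ~ has_grid s A ->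
  wt A n n <= 8 * wide_bound s d t * t * n.
Proof.
move=> s0 sd wt_.
have t4 : 3 < t.
  by apply: leq_trans wt_; rewrite -[4]muln1 leq_mul2l expn_gt0 muln_gt0 s0 expn_gt0.
have t0 : 0 < t by lia.
have wb0 : 0 < wide_bound s d t by rewrite !muln_gt0 s0 !expn_gt0 !muln_gt0 !expn_gt0.
elim/ltn_ind: n A => n IH A nA.
have wtnn : wt A n n <= n * n.
  rewrite /wt -[n in n * _]subn0 -sum_nat_const_nat; apply: leq_sum => i _.
  rewrite -[n in leqRHS]subn0 -[leqRHS]muln1 -sum_nat_const_nat; apply: leq_sum => j _.
  exact: leq_b1.
have [nt|tn] := ltnP n t.
  apply: leq_trans wtnn _; rewrite leq_mul2r; apply/orP; right; nia.
pose m := (n %/ t).+1.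
have nm : n <= m * t by rewrite mulnC ltnW // mulnC ltn_ceil.
have mt : m * t <= 2 * n.
  by rewrite mulSn; have := leq_divM n t; lia.
have mn : m < n by nia.
apply: leq_trans (leq_wt A nm nm) _.
apply: leq_trans (wt_contract m s0 sd t0 nA) _.
have := IH m mn _ (fun h => nA (has_grid_block t0 h)).
move: (wt (block t A) m m) (wide_bound s d t) wb0 (s * 2 ^ d) wt_ => W R R0 w wt_ HW.
(* As [4 * w ^ 2 <= t], the recursive term is at most [2 * R * t * (m * t)], which is also the share
   of wide and tall blocks; with [m * t <= 2 * n] the sum is at most [8 * R * t * n]. *)
have h1 : 4 * (w ^ 2 * W) <= 8 * R * t * (m * t).
  by have := leq_mul wt_ HW; lia.
have h2 : 8 * R * t * (m * t) <= 8 * R * t * (2 * n) by rewrite leq_mul2l mt orbT.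
have h3 : R * t * (m * t) <= R * t * (2 * n) by rewrite leq_mul2l mt orbT.
rewrite -mulnn in h1 *; lia.
Qed.

(** * From boolean matrices to relations; the extremal function *)

Definition mxrel m n (A : 'M[bool]_(m, n)) (i j : nat) : bool :=
  if insub i is Some i' then if insub j is Some j' then A i' j' else false else false.

Lemma mxrelE m n (A : 'M[bool]_(m, n)) (i : 'I_m) (j : 'I_n) : mxrel A i j = A i j.
Proof. by rewrite /mxrel !valK. Qed.

Lemma mxrelP m n (A : 'M[bool]_(m, n)) i j :
  mxrel A i j -> exists (i' : 'I_m) (j' : 'I_n), [/\ val i' = i, val j' = j & A i' j'].
Proof.
rewrite /mxrel; case: insubP => // i' _ <-; case: insubP => // j' _ <- Aij.
by exists i', j'.
Qed.

Lemma weight_wt n (A : 'M[bool]_n) : weight A = wt (mxrel A) n n.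
Proof.
rewrite /weight -sum1_card big_mkcond /= /wt big_mkord.
under [RHS]eq_bigr do rewrite big_mkord.
rewrite pair_bigA /=; apply: eq_bigr => -[i j] _.
by rewrite inE mxrelE /=; case: (A i j).
Qed.

Lemma lexlt_divmod s i j : i < j -> lexlt (i %/ s) (i %% s) (j %/ s) (j %% s).
Proof.
move=> ij; rewrite /lexlt; case: ltngtP (leq_div2r s (ltnW ij)) => //= e _.
by move: ij; rewrite {1}(divn_eq i s) {1}(divn_eq j s) e ltn_add2l.
Qed.

Lemma lexlt_add s x y x' y' : y < s -> lexlt x y x' y' -> y + x * s < y' + x' * s.
Proof.
move=> ys /orP[xx'|/andP[/eqP<- yy']]; last by rewrite ltn_add2r.
by have := leq_mul xx' (leqnn s); rewrite mulSn; lia.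
Qed.

(** The order of indices below [s ^ 2] is the lexicographic order of quotient and remainder by [s]:
    for a row the quotient is [b], for a column it is [a]. *)
Lemma contains_grid s n (A : 'M[bool]_n) :
  reflect (has_grid s (mxrel A)) (contains A (G s)).
Proof.
apply: (iffP idP).
  move=> /existsP[f /existsP[g /and3P[finc ginc H]]].
  pose e (h : {ffun 'I_(s ^ 2) -> 'I_n}) x : nat := if insub x is Some i then h i else 0.
  have eE (h : {ffun 'I_(s ^ 2) -> 'I_n}) (x : 'I_(s ^ 2)) : e h x = h x by rewrite /e valK.
  have einc (h : {ffun 'I_(s ^ 2) -> 'I_n}) (x y : 'I_(s ^ 2)) :
      increasing_ord h -> x < y -> e h x < e h y.
    by move=> /forallP/(_ x)/forallP/(_ y)/implyP; rewrite !eE.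
  have lt2 x y : x < s -> y < s -> x + y * s < s ^ 2.
    by move=> xs ys; rewrite -mulnn; have := leq_mul ys (leqnn s); rewrite mulSn; lia.
  exists (fun a b => e f (a + b * s)), (fun a b => e g (b + a * s)) => a b as_ bs.
  pose i := Ordinal (lt2 _ _ as_ bs); pose j := Ordinal (lt2 _ _ bs as_).
  split.
    move: H => /forallP/(_ i)/forallP/(_ j)/implyP.
    rewrite !mxE (eE f i) (eE g j) mxrelE; apply.
    by apply/existsP; exists (Ordinal as_); apply/existsP; exists (Ordinal bs); rewrite /= !eqxx.
  move=> a' b' as' bs'.
  pose i' := Ordinal (lt2 _ _ as' bs'); pose j' := Ordinal (lt2 _ _ bs' as').
  split=> [/(lexlt_add as_)|/(lexlt_add bs)]; first exact: (@einc f i i').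
  exact: (@einc g j j').
move=> [r [c H]].
(* For [s = 0] the pattern is empty and empty functions embed it; the remainders below need
   [0 < s]. *)
have [->|s0] := posnP s.
  by apply/existsP; exists (ffun0 (card_ord 0)); apply/existsP; exists (ffun0 (card_ord 0));
  apply/and3P; split; apply/forallP => -[].
have divs (i : 'I_(s ^ 2)) : i %/ s < s by rewrite ltn_divLR // mulnn.
have mods (i : 'I_(s ^ 2)) : i %% s < s by rewrite ltn_mod.
have /fin_all_exists[f fP] (i : 'I_(s ^ 2)) : exists x : 'I_n, val x = r (i %% s) (i %/ s).
  by have [/mxrelP[x [_ [<- _ _]]] _] := H _ _ (mods i) (divs i); exists x.
have /fin_all_exists[g gP] (i : 'I_(s ^ 2)) : exists x : 'I_n, val x = c (i %/ s) (i %% s).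
  by have [/mxrelP[_ [x [_ <- _]]] _] := H _ _ (divs i) (mods i); exists x.
apply/existsP; exists (finfun f); apply/existsP; exists (finfun g); apply/and3P; split.
- apply/forallP => i; apply/forallP => j; apply/implyP => /(lexlt_divmod s).
  rewrite !ffunE; have := fP i; have := fP j; rewrite /= => -> ->.
  by apply (H _ _ (mods i) (divs i)).
- apply/forallP => i; apply/forallP => j; apply/implyP => /(lexlt_divmod s).
  rewrite !ffunE; have := gP i; have := gP j; rewrite /= => -> ->.
  by apply (H _ _ (divs i) (mods i)).
- apply/forallP => i; apply/forallP => j; apply/implyP.
  rewrite !mxE !ffunE => /existsP[a /existsP[b /andP[/eqP ei /eqP ej]]].
  rewrite -mxrelE; have := fP i; have := gP j; rewrite /= => -> ->.
  rewrite ei ej (addnC a) (addnC b) !modnMDl !divnMDl // !modn_small // !divn_small // !addn0.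
  by have [] := H a b (ltn_ord _) (ltn_ord _).
Qed.

(** The zero matrix avoids [G s], so the maximum is over a nonempty set. *)
Lemma ex_attained s n : 0 < s -> exists2 A : 'M[bool]_n, ~ has_grid s (mxrel A) &
  ex n (G s) = wt (mxrel A) n n.
Proof.
move=> s0.
have av0 : avoids (const_mx false : 'M[bool]_n) (G s).
  apply/contains_grid => -[r [c /(_ 0 0 s0 s0)[/mxrelP[i [j [_ _]]]]]].
  by rewrite mxE.
have : 0 < #|[pred A : 'M[bool]_n | avoids A (G s)]| by apply/card_gt0P; exists (const_mx false).
move=> /(eq_bigmax_cond (@weight n n))[A] /contains_grid nA eA.
by exists A; rewrite // -weight_wt -eA.
Qed.

Lemma leq_ex s n (A : nat -> nat -> bool) :
  ~ has_grid s A -> wt A n n <= ex n (G s).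
Proof.
move=> nA; pose D : 'M[bool]_n := (\matrix_(i, j) A i j)%R.
have -> : wt A n n = weight D.
  rewrite weight_wt /wt !big_mkord; apply: eq_bigr => i _.
  by rewrite !big_mkord; apply: eq_bigr => j _; rewrite mxrelE mxE.
apply: (leq_bigmax_cond (F := @weight n n)); apply/contains_grid => hD; apply: nA.
apply: (@has_grid_lift s A _ id id _ _ _ hD) => //.
by move=> I J /mxrelP[i [j [<- <-]]]; rewrite mxE; exists i, j.
Qed.

(* The grid has a 1-entry in its top left corner, so an occurrence in a matrix made of
   a top right and a bottom left block lies entirely in one of the two blocks. *)
Lemma ex_superadditive s m n : 0 < s -> ex m (G s) + ex n (G s) <= ex (m + n) (G s).
Proof.
move=> s0; have [A nA ->] := ex_attained m s0; have [B nB ->] := ex_attained n s0.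
pose D i j := if i < m then (n <= j) && mxrel A i (j - n) else (j < n) && mxrel B (i - m) j.
apply: (@leq_trans (wt D (m + n) (m + n))); last first.
  apply: leq_ex => -[r [c H]].
  have corner a b : a < s -> b < s -> r 0 0 <= r a b /\ c 0 0 <= c a b.
    move=> as_ bs; have [_ /(_ a b as_ bs)[Hr Hc]] := H 0 0 s0 s0.
    have [ab0|ab0] := posnP (a + b); first by have [-> ->] : a = 0 /\ b = 0 by lia.
    by split; apply: ltnW; [apply: Hr|apply: Hc]; rewrite /lexlt; lia.
  have [D00 _] := H 0 0 s0 s0; move: D00; rewrite /D.
  (* If the corner is in the top right block, all columns used are at least [n], which excludes the
     bottom left block; otherwise all rows used are at least [m]. *)
  case: ltnP => [rm /andP[nc _]|mr /andP[cn _]].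
    apply: nA; exists r, (fun a b => c a b - n) => a b as_ bs.
    have cab a' b' (h : a' < s) (h' : b' < s) := leq_trans nc (corner a' b' h h').2.
    have [Dab Hab] := H a b as_ bs; split.
      move: Dab; rewrite /D; case: ltnP => [_ /andP[]//|_ /andP[]].
      by rewrite ltnNge cab.
    move=> a' b' as' bs'; have [Hr Hc] := Hab a' b' as' bs'; split=> // /Hc.
    by rewrite ltn_sub2rE // cab.
  apply: nB; exists (fun a b => r a b - m), c => a b as_ bs.
  have rab a' b' (h : a' < s) (h' : b' < s) := leq_trans mr (corner a' b' h h').1.
  have [Dab Hab] := H a b as_ bs; split.
    move: Dab; rewrite /D; case: ltnP => [|_ /andP[]//].
    by rewrite ltnNge rab.
  move=> a' b' as' bs'; have [Hr Hc] := Hab a' b' as' bs'; split=> // /Hr.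
  by rewrite ltn_sub2rE // rab.
rewrite [leqRHS]/wt (big_cat_nat (leq0n m) (leq_addr n m)) /= leq_add //.
  rewrite /wt big_nat [leqRHS]big_nat; apply: leq_sum => i /andP[_ im].
  rewrite (big_cat_nat (leq0n n) (leq_addl m n)) /=; apply: leq_trans (leq_addl _ _).
  rewrite -[n in leqRHS]add0n big_addn addnK; apply: leq_sum => j _.
  by rewrite /D im leq_addl addnK.
rewrite -[m in leqRHS]add0n big_addn addnC addnK; apply: leq_sum => i _.
rewrite addnC (big_cat_nat (leq0n n) (leq_addl m n)) /=; apply: leq_trans (leq_addr _ _).
rewrite big_nat [leqRHS]big_nat; apply: leq_sum => j /andP[_ jn].
by rewrite /D ltnNge leq_addl /= jn addnK.
Qed.

Lemma ex_linear s d n : 0 < s -> s <= 2 ^ d ->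
  ex n (G s) <= 8 * wide_bound s d (4 * (s * 2 ^ d) ^ 2) * (4 * (s * 2 ^ d) ^ 2) * n.
Proof. by move=> s0 sd; have [A nA ->] := ex_attained n s0; apply: wt_linear. Qed.

Lemma bound_le_exp2 s d : 0 < d -> 0 < s -> s <= 2 ^ d ->
  8 * wide_bound s d (4 * (s * 2 ^ d) ^ 2) * (4 * (s * 2 ^ d) ^ 2) <= 2 ^ (32 * d ^ 2 * s).
Proof.
move=> d0 s0 sd; set t := 4 * _.
have t_le : t <= 2 ^ (6 * d).
  apply: (@leq_trans (2 ^ 2 * (2 ^ d * 2 ^ d) ^ 2)).
    by rewrite leq_mul2l leq_exp2r // leq_mul2r sd orbT.
  by rewrite -!expnD -expnM -expnD leq_exp2l //; lia.
have t1_le : t.+1 <= 2 ^ (7 * d).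
  apply: leq_trans (leq_ltn_trans t_le _) _; last exact: leqnn.
  by rewrite ltn_exp2l //; lia.
rewrite /wide_bound.
apply: (@leq_trans (2 ^ 3 * ((2 ^ (7 * d)) ^ s.+1 * (2 ^ d * (2 ^ 1 * (2 ^ (7 * d)) ^ s) ^ d))
  * 2 ^ (6 * d))).
  rewrite !leq_mul // ?leq_exp2r // ?leq_mul2l ?leq_exp2r //.
rewrite -!expnM -!expnD -!expnM -!expnD leq_exp2l //.
(* The exponent is [7 * d ^ 2 * s + 7 * d * s + 15 * d + 3]; as [d * s], [d] and 1 are at most
   [d ^ 2 * s], the coefficients add up to 32. *)
have : d <= d ^ 2 * s by rewrite -mulnn -mulnA -[leqLHS]muln1 leq_mul2l muln_gt0 d0 s0 orbT.
have : d * s <= d ^ 2 * s by rewrite leq_mul2r -mulnn -[leqLHS]muln1 leq_mul2l d0 !orbT.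
rewrite -!mulnn; nia.
Qed.

(** * Existence of the limit and the final estimate *)

Local Open Scope classical_set_scope.
Local Open Scope ring_scope.

(** Fekete's lemma: the limit is the supremum, since [n = q * p + r] gives [u n >= q * u p]. *)
Lemma cvg_superadditive (R : realType) (u : nat -> nat) (K : nat) :
  (forall m n, u m + u n <= u (m + n))%N -> (forall n, u n <= K * n)%N ->
  cvgn (fun n => (u n)%:R / n%:R : R).
Proof.
move=> usup uK; pose v n : R := (u n)%:R / n%:R.
pose L := sup (range (fun n => v n.+1)).
have vub n : v n.+1 <= K%:R by rewrite ler_pdivrMr ?ltr0n // -natrM ler_nat.
have hs : has_sup (range (fun n => v n.+1)).
  split; first by exists (v 1%N), 0%N.
  by exists K%:R => _ [n _ <-].
apply/cvg_ex; exists L; apply/cvgrPdist_le => e e0.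
have e2 : 0 < e / 2 by rewrite divr_gt0.
have [_ [p _ <-] Lp] := sup_adherent e2 hs.
have umul q : (q * u p.+1 <= u (q * p.+1))%N.
  elim: q => // q IH; rewrite !mulSn; apply: leq_trans (usup _ _).
  by rewrite leq_add2l.
exists (Num.truncn ((u p.+1)%:R / (e / 2))).+1 => // n /= Nn.
case: n Nn => // n Nn.
have vL : v n.+1 <= L by apply: ub_le_sup; [exact: hs.2|exists n].
rewrite -/(v n.+1) ger0_norm ?subr_ge0 //.
have n0 : 0 < n.+1%:R :> R by rewrite ltr0n.
have p0 : 0 < p.+1%:R :> R by rewrite ltr0n.
have un : (u p.+1)%:R / n.+1%:R <= e / 2.
  rewrite ler_pdivrMr // mulrC -ler_pdivrMr //.
  by apply: le_trans (ltW (truncnS_gt _)) _; rewrite ler_nat.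
(* Rounding [n.+1] down to a multiple of [p.+1] loses at most one copy of [u p.+1]. *)
have : v p.+1 - (u p.+1)%:R / n.+1%:R <= v n.+1.
  rewrite /v ler_pdivlMr // mulrBl divfK ?lt0r_neq0 // lerBlDr mulrAC ler_pdivrMr //.
  rewrite -natrD -!natrM ler_nat.
  apply: (@leq_trans (u p.+1 * ((n.+1 %/ p.+1).+1 * p.+1))).
    by rewrite leq_mul2l ltnW ?orbT // ltn_ceil.
  rewrite mulnA leq_mul2r orFb mulnC mulSn addnC leq_add2r.
  apply: leq_trans (umul _) _; rewrite {2}(divn_eq n.+1 p.+1).
  by apply: leq_trans (usup _ _); apply: leq_addr.
move=> vp.
have aux (x y z w h : R) : x - h < y -> z <= h -> y - z <= w -> x - w <= h + h by lra.
by have := aux _ _ _ _ _ Lp un vp; rewrite -splitr.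
Qed.

Theorem theorem1p3 (R : realType) :
  exists C : R, 0 < C /\
    forall k s : nat, (1 <= k)%N -> k = (s ^ 2)%N ->
      cvgn (ex_ratio R (G s)) /\
      c_ R (G s) <= 2 `^ (C * Num.sqrt k%:R * log2 k%:R ^+ 2).
Proof.
exists 32; split=> // k s k1 ks.
have s0 : (0 < s)%N by move: k1; rewrite ks sqrn_gt0.
have [K HK KB] : exists2 K : nat, (forall n, ex n (G s) <= K * n)%N &
    K%:R <= 2 `^ (32 * Num.sqrt k%:R * log2 k%:R ^+ 2) :> R.
  (* For [s = 1] rounding up would give [d = 0], which [bound_le_exp2] excludes; a matrix avoiding
     [G 1] is zero, so [K = 0] works. *)
  have [s1|s2] := leqP s 1.
    have {}s1 : s = 1%N by lia.
    exists 0%N; last by rewrite powR_ge0.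
    move=> n; rewrite s1; have [A nA ->] := ex_attained n (ltn0Sn 0).
    rewrite leqn0 /wt big1 // => i _; rewrite big1 // => j _.
    apply/eqP; rewrite eqb0; apply/negP => Aij; apply: nA.
    exists (fun _ _ => i), (fun _ _ => j) => a b; rewrite !ltnS !leqn0 => /eqP-> /eqP->.
    by split=> // a' b'; rewrite !ltnS !leqn0 => /eqP-> /eqP->; rewrite /lexlt.
  have /andP[ds sd] := up_log_bounds (ltnSn 1) s2.
  set d := up_log 2 s in ds sd.
  have d0 : (0 < d)%N by rewrite lt0n; apply/eqP => d0; rewrite d0 in sd; lia.
  (* Since [2 ^ d.-1 < s] and [2 <= s], doubling gives at most [s ^ 2]; hence [d <= log2 k]. *)
  have dk : (2 ^ d <= k)%N.
    rewrite -(prednK d0) expnS ks -mulnn; exact: leq_mul (ltnW ds).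
  exists (8 * wide_bound s d (4 * (s * 2 ^ d) ^ 2) * (4 * (s * 2 ^ d) ^ 2))%N.
    by move=> n; apply: ex_linear.
  apply: (@le_trans _ _ (2 ^ (32 * d ^ 2 * s))%:R).
    by rewrite ler_nat bound_le_exp2.
  rewrite natrX -[leLHS]powR_mulrn //; apply: ler_powR; first by rewrite ler1n.
  have -> : Num.sqrt k%:R = s%:R :> R by rewrite ks natrX sqrtr_sqr ger0_norm.
  rewrite natrM natrM natrX mulrAC ler_wpM2l ?mulr_ge0 //.
  have ln2 : 0 < ln 2 :> R by rewrite ln_gt0 // ltr1n.
  have dlog : d%:R <= log2 k%:R :> R.
    rewrite /log2 ler_pdivlMr // mulrC mulr_natr -lnXn // -natrX.
    by rewrite ler_ln ?posrE ?ltr0n ?expn_gt0 // ler_nat.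
  by rewrite lerXn2r ?nnegrE ?(le_trans _ dlog).
have cv := @cvg_superadditive R _ K (fun m n => ex_superadditive m n s0) HK.
split=> //; apply: le_trans KB; apply: limr_le => //.
apply: nearW => n; rewrite /ex_ratio; case: n => [|n].
  (* At [n = 0] the ratio is 0, by the convention for division by zero. *)
  by rewrite invr0 mulr0.
by rewrite ler_pdivrMr ?ltr0n // -natrM ler_nat.
Qed.
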